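(* Let $r\ge s\ge 1$ be integers, let $G$ be an abelian group, and let $S\neq G$ be a finite non-empty subset of $G$ such that $G$ is generated by $S-S$. Let $H$ be a hyper-atom of $S$. Then at least one of the following holds: (i) $S$ is an arithmetic progression; (ii) $|sS-rS|\ge \min\big(|G|-1,\,(r+s)|S|\big)$; (iii) $H$ is a non-zero subgroup and $sS-rS+H=sS-rS$.
   Context: Notation: $A+B=\{a+b: a\in A,\ b\in B\}$, $A-B=\{a-b: a\in A,\ b\in B\}$, $kS=S+\cdots+S$ ($k$ summands), and $sS-rS=\{x-y: x\in sS,\ y\in rS\}$. An arithmetic progression is a set of the form $\{a,a+d,\dots,a+(m-1)d\}$ with $m\ge 1$. If $G$ is infinite then $|G|-1=\infty$. Let $S$ be a finite non-empty proper subset of $G$ such that $S-S$ generates $G$ (equivalently, $S$ generates $G$ when $0\in S$). Put $$\kappa_1(S)=\min\{|X+S|-|X| : X\subset G \text{ finite non-empty},\ X+S\neq G\}.$$ A ($1$-)fragment of $S$ is a finite non-empty set $X\subset G$ with $X+S\ne G$ and $|X+S|-|X|=\kappa_1(S)$. (It is known that some subgroup of $G$, possibly $\{0\}$, is a $1$-fragment of $S$.) A hyper-atom of $S$ is a maximal element (for inclusion) among the subgroups of $G$ that are $1$-fragments of $S$. *)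

(* Defs.v *)
From mathcomp Require Import all_boot all_order all_algebra.
From mathcomp Require Import finmap.
From mathcomp Require Import boolp classical_sets cardinality.

Set Implicit Arguments.
Unset Strict Implicit.
Unset Printing Implicit Defensive.

Import GRing.Theory.
Local Open Scope nat_scope.
Local Open Scope fset_scope.
Local Open Scope classical_set_scope.

Section Defs.
Variable G : zmodType.
Implicit Types (A B S X H K : {fset G}) (k m n r s : nat).

Definition sumset A B : {fset G} := [fset (a + b)%R | a in A, b in B]%fset.

Definition diffset A B : {fset G} := [fset (a - b)%R | a in A, b in B]%fset.

(* 0A = {0}, so that kA has exactly k summands equal to A. *)
Definition ksum k A : {fset G} := iter k (sumset A) [fset 0%R]%fset.

Definition arith_prog A : Prop :=
  exists (a d : G) (m : nat),
    1 <= m /\ A = [fset (a + d *+ i)%R | i in iota 0 m]%fset.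

Definition subgroup (L : set G) : Prop :=
  L 0%R /\ forall x y, L x -> L y -> L (x - y)%R.

Definition generated (D : set G) : set G := smallest subgroup D.

Definition proper A : Prop := [set` A] <> [set: G].

Definition admissible S X : Prop := X <> fset0 /\ proper (sumset X S).

(* |X + S| >= |X| whenever S is non-empty, so the subtraction does not
   truncate in that case. *)
Definition excess S X : nat := #|` sumset X S| - #|` X|.

Definition is_min (E : set nat) n : Prop := E n /\ forall j, E j -> n <= j.

(* The set of excesses is non-empty as soon as S <> G (take X = {0}), so the
   default value 0 of xget is then not used; see kappa1P. *)
Definition kappa1 S : nat :=
  xget 0 (is_min [set excess S X | X in admissible S]).

Definition fragment S X : Prop := admissible S X /\ excess S X = kappa1 S.

Definition hyperatom S H : Prop :=
  [/\ subgroup [set` H], fragment S H &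
      forall K, subgroup [set` K] -> fragment S K ->
        (H `<=` K)%fset -> K = H].

(* min (|G| - 1, n), where |G| - 1 is infinite if G is. *)
Definition min_card_pred n : nat :=
  if `[< finite_set [set: G] >]
  then minn (#|` fset_set [set: G]| - 1) n
  else n.

Lemma sumset0l S : sumset [fset 0%R]%fset S = S.
Proof.
apply/fsetP => x; apply/imfset2P/idP => /= [[a /[!inE]/eqP-> [b bS ->]]|xS].
  by rewrite add0r.
by exists 0%R; [rewrite inE | exists x; rewrite ?add0r].
Qed.

Lemma leq_card_sumset S X : S <> fset0 -> #|` X| <= #|` sumset X S|.
Proof.
move=> /eqP/fset0Pn[b bS].
have <- := card_imfset imfset_key (mem X) (@addIr G b).
apply: fsubset_leq_card; apply/fsubsetP => x /imfsetP[a aX ->].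
by apply/imfset2P; exists a => //; exists b.
Qed.

Lemma kappa1P S : proper S ->
  is_min [set excess S X | X in admissible S] (kappa1 S).
Proof.
move=> pS; rewrite /kappa1.
set E := [set excess S X | X in admissible S].
have [n En] : exists n, `[< E n >].
  exists (excess S [fset 0%R]%fset); apply/asboolP.
  exists [fset 0%R]%fset => //; split; last by rewrite sumset0l.
  by apply/eqP/fset0Pn; exists 0%R; rewrite inE.
case: (ex_minnP (ex_intro (fun n => `[< E n >]) n En)) => m /asboolP Em minm.
by apply: (@xgetPex _ 0 (is_min E)); exists m; split=> // j /asboolP; apply: minm.
Qed.

End Defs.

(* Main.v *)
Require Import Defs.
From mathcomp Require Import all_boot all_order all_algebra.
From mathcomp Require Import finmap.
From mathcomp Require Import boolp classical_sets cardinality.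
From mathcomp Require Import zify.

(** If [H <> 0], then [|H + S| < |H| + |S|] forces the parts of [S] in any two
    distinct [H]-cosets to have more than [|H|] elements together; hence [S - S],
    and with it [sS - rS], is [H]-periodic.

    If [H = 0], every non-zero finite subgroup [K] with [K + S <> G] satisfies
    [|K + S| >= |K| + |S|].  Unless [|X + S| >= |X| + |S|] holds for all [X] with
    [|X| >= 2] and at least two elements outside [X + S] (which gives the bound by
    adding copies of [S] one at a time), take a 2-atom [M] of [S] containing [0].
    Distinct translates of [M] meet in at most one point, so [M] is a subgroup,
    which is excluded, or a Sidon set.  A Sidon set with three elements or more
    expands in the subgroup [<M>], and splitting [S] along the cosets of [<M>]
    gives a contradiction.  So [M = {0, d}], and [S] is a progression of
    difference [d] together with a [d]-periodic set; when the latter is non-empty,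
    the assumption on subgroups gives [2|S| > |G|], whence [S - S = G]. *)

Set Implicit Arguments.
Unset Strict Implicit.
Unset Printing Implicit Defensive.

Import GRing.Theory.
Local Open Scope nat_scope.
Local Open Scope classical_set_scope.

(** * Cardinalities of finite sets *)

Section FsetCard.
Local Open Scope fset_scope.
Local Open Scope nat_scope.

Lemma cardfs_gt1P (E : choiceType) (X : {fset E}) :
  reflect (exists x y, [/\ x \in X, y \in X & x != y]) (1 < #|` X|).
Proof.
apply: (iffP idP) => [X2|[x [y [xX yX xy]]]].
  have /fset0Pn[x xX] : X != fset0 by rewrite -cardfs_gt0; lia.
  have /fset0Pn[y] : X `\ x != fset0.
    by rewrite -cardfs_gt0; move: X2; rewrite (cardfsD1 x) xX; lia.
  by rewrite !inE eq_sym => /andP[xy yX]; exists x, y.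
have -> : 2 = #|` [fset x; y]| by rewrite cardfs2 xy.
by apply/fsubset_leq_card/fsubsetP => z; rewrite !inE => /orP[]/eqP->.
Qed.

Lemma cardfsU_disjoint (E : choiceType) (X Y Z : {fset E}) :
  X `<=` Z -> Y `<=` Z -> [disjoint X & Y] -> #|` X| + #|` Y| <= #|` Z|.
Proof.
move=> XZ YZ /eqP dXY; have := cardfsUI X Y; rewrite dXY cardfs0 addn0 => <-.
by apply: fsubset_leq_card; rewrite fsubUset XZ.
Qed.

End FsetCard.

Section Isoperimetric.
Local Open Scope fset_scope.
Local Open Scope nat_scope.
Variable G : zmodType.
Implicit Types (A B C F K M N S T X Y : {fset G}) (L : set G) (d g u v x y z : G).

(** * Sumsets, difference sets, translates and subgroups *)

Lemma sumsetP A B x :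
  reflect (exists a b, [/\ a \in A, b \in B & x = (a + b)%R]) (x \in sumset A B).
Proof.
apply: (iffP (imfset2P _ _ _ _ _)) => [[a aA [b bB ->]]|[a [b [aA bB ->]]]].
  by exists a, b.
by exists a => //; exists b.
Qed.

Lemma diffsetP A B x :
  reflect (exists a b, [/\ a \in A, b \in B & x = (a - b)%R]) (x \in diffset A B).
Proof.
apply: (iffP (imfset2P _ _ _ _ _)) => [[a aA [b bB ->]]|[a [b [aA bB ->]]]].
  by exists a, b.
by exists a => //; exists b.
Qed.

Lemma mem_sumset A B a b : a \in A -> b \in B -> (a + b)%R \in sumset A B.
Proof. by move=> aA bB; apply/sumsetP; exists a, b. Qed.

Lemma mem_diffset A B a b : a \in A -> b \in B -> (a - b)%R \in diffset A B.
Proof. by move=> aA bB; apply/diffsetP; exists a, b. Qed.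

Lemma sumsetC A B : sumset A B = sumset B A.
Proof.
by apply/fsetP=> x; apply/sumsetP/sumsetP => -[a [b [aA bB ->]]]; exists b, a;
  rewrite addrC.
Qed.

Lemma sumsetSl A B C : A `<=` B -> sumset A C `<=` sumset B C.
Proof.
move=> /fsubsetP sAB; apply/fsubsetP => x /sumsetP[a [c [aA cC ->]]].
by rewrite mem_sumset ?sAB.
Qed.

Lemma sumset_addl A B : 0%R \in B -> A `<=` sumset A B.
Proof. by move=> B0; apply/fsubsetP => x xA; rewrite -[x]addr0 mem_sumset. Qed.

Lemma sumsetUl A B C : sumset (A `|` B) C = sumset A C `|` sumset B C.
Proof.
apply/fsetP=> x; rewrite inE; apply/sumsetP/orP => [[a [c [+ cC ->]]]|].
  by rewrite inE => /orP[aA|aB]; [left|right]; rewrite mem_sumset.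
by case=> /sumsetP[a [c [aA cC ->]]]; exists a, c; rewrite inE aA ?orbT.
Qed.

Definition shift g X : {fset G} := [fset (x + g)%R | x in X].

Lemma mem_shift g X x : (x \in shift g X) = ((x - g)%R \in X).
Proof.
apply/imfsetP/idP => /= [[y yX ->]|xX]; first by rewrite addrK.
by exists (x - g)%R => //; rewrite subrK.
Qed.

Lemma card_shift g X : #|` shift g X| = #|` X|.
Proof. by rewrite /shift card_imfset // => x y /addIr. Qed.

Lemma sumset_shiftl g X T : sumset (shift g X) T = shift g (sumset X T).
Proof.
apply/fsetP=> x; rewrite mem_shift; apply/sumsetP/sumsetP => -[a [b [aX bT e]]].
  by exists (a - g)%R, b; rewrite -mem_shift aX bT e; split=> //; rewrite addrAC.
exists (a + g)%R, b; rewrite mem_shift addrK; split=> //.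
by rewrite addrAC -e subrK.
Qed.

Lemma subgroup0 L : subgroup L -> L 0%R. Proof. by case. Qed.

Lemma subgroupB L x y : subgroup L -> L x -> L y -> L (x - y)%R.
Proof. by case=> _; apply. Qed.

Lemma subgroupN L x : subgroup L -> L x -> L (- x)%R.
Proof. by move=> gL Lx; rewrite -sub0r; apply: subgroupB => //; apply: subgroup0. Qed.

Lemma subgroupD L x y : subgroup L -> L x -> L y -> L (x + y)%R.
Proof.
move=> gL Lx Ly; rewrite -[y]opprK.
by apply: subgroupB => //; apply: subgroupN.
Qed.

Lemma subgroup_generated (D : set G) : subgroup (generated D).
Proof.
split=> [|x y gx gy] L [gL DL]; first exact: subgroup0.
by apply: subgroupB => //; [apply: gx | apply: gy].
Qed.

(** * 2-atoms inside a subgroup *)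

(** Explicit witnesses replace a cardinality, since [L] may be infinite. *)
Definition two_outside L Y : Prop :=
  exists u v, [/\ u != v, L u, L v, u \notin Y & v \notin Y].

Lemma two_outside_shift L Y g : subgroup L -> L g ->
  two_outside L Y -> two_outside L (shift g Y).
Proof.
move=> gL Lg [u [v [uv Lu Lv uY vY]]]; exists (u + g)%R, (v + g)%R.
by rewrite !mem_shift !addrK (inj_eq (addIr g)); split=> //; apply: subgroupD.
Qed.

Lemma two_outsideS L X Y : X `<=` Y -> two_outside L Y -> two_outside L X.
Proof.
move=> /fsubsetP sXY [u [v [uv Lu Lv uY vY]]]; exists u, v; split=> //.
  by apply: contra uY => /sXY.
by apply: contra vY => /sXY.
Qed.

(** If no two points of [L] avoid [Y], then [L] lies in [Y] plus one point; [F] lists it. *)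
Lemma two_outsideVfinite L Y : two_outside L Y \/
  exists2 F, (forall x, x \in F <-> L x) & #|` F `\` Y| <= 1.
Proof.
have [?|nL] := pselect (two_outside L Y); [by left | right].
have [[u [Lu uY]]|nu] := pselect (exists u, L u /\ u \notin Y).
  exists [fset x in u |` Y | `[< L x >]].
    move=> x; rewrite !inE; split=> [/andP[_ /asboolP]|Lx] //.
    rewrite asboolT // andbT; have [//|xu /=] := eqVneq x u.
    by apply: contrapT => /negP xY; apply: nL; exists x, u.
  rewrite -(cardfs1 u); apply/fsubset_leq_card/fsubsetP => x.
  by rewrite !inE => /andP[xY] /andP[/orP[//|]]; rewrite (negPf xY).
exists [fset x in Y | `[< L x >]].
  move=> x; rewrite !inE; split=> [/andP[_ /asboolP]|Lx] //.
  by rewrite asboolT // andbT; apply: contrapT => /negP xY; apply: nu; exists x.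
rewrite leqW // leqn0 cardfs_eq0; apply/eqP/fsetP => x.
by rewrite !inE; case: (x \in Y).
Qed.

(** The sets competing for the second isoperimetric number of [T] in [L]. *)
Definition candidate L T X : Prop :=
  [/\ forall x, x \in X -> L x, 1 < #|` X| & two_outside L (sumset X T)].

(* The inequalities say that M minimises |X + T| - |X| and, among the minimisers,
   has least cardinality. *)
Definition atom L T M : Prop := candidate L T M /\
  forall X, candidate L T X ->
    #|` sumset M T| + #|` X| < #|` sumset X T| + #|` M| \/
    #|` sumset M T| + #|` X| = #|` sumset X T| + #|` M| /\ #|` M| <= #|` X|.

Lemma atom_exists L T X : T <> fset0 -> candidate L T X -> exists M, atom L T M.
Proof.
move=> T0 cX.
pose P n := exists Y, candidate L T Y /\ #|` sumset Y T| - #|` Y| = n.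
have exP : exists n, `[< P n >].
  by exists (#|` sumset X T| - #|` X|); apply/asboolP; exists X.
case: (ex_minnP exP) => n /asboolP[Y [cY eY]] minn.
pose Q k := exists Z, [/\ candidate L T Z, #|` sumset Z T| - #|` Z| = n & #|` Z| = k].
have exQ : exists k, `[< Q k >] by exists #|` Y|; apply/asboolP; exists Y.
case: (ex_minnP exQ) => k /asboolP[M [cM eM Mk]] mink.
exists M; split=> // Z cZ.
have := leq_card_sumset Z T0; have := leq_card_sumset M T0.
have : n <= #|` sumset Z T| - #|` Z| by apply/minn/asboolP; exists Z.
rewrite leq_eqVlt => /orP[/eqP eZ|]; last by lia.
have : k <= #|` Z| by apply/mink/asboolP; exists Z.
by lia.
Qed.

Lemma candidate_shift L T X g : subgroup L -> L g ->
  candidate L T X -> candidate L T (shift g X).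
Proof.
move=> gL Lg [XL X2 o2]; split.
- by move=> x; rewrite mem_shift => /XL /(subgroupD gL) /(_ Lg); rewrite subrK.
- by rewrite card_shift.
- by rewrite sumset_shiftl; apply: two_outside_shift.
Qed.

Lemma atom_shift L T M g : subgroup L -> L g ->
  atom L T M -> atom L T (shift g M).
Proof.
move=> gL Lg [cM minM]; split; first exact: candidate_shift.
by rewrite sumset_shiftl !card_shift.
Qed.

(* The complement of M + T in L is, up to sign, again a minimiser. *)
Lemma atom_card_leq L T M F : subgroup L -> (forall t, t \in T -> L t) ->
  (forall x, x \in F <-> L x) -> atom L T M ->
  #|` M| + #|` sumset M T| <= #|` F|.
Proof.
move=> gL TL FL [[ML M2 o2] minM]; have [u [v [uv Lu Lv uY vY]]] := o2.
pose D := F `\` sumset M T.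
pose C := [fset (- x)%R | x in D].
have cC : #|` C| = #|` D| by rewrite card_imfset //; apply: oppr_inj.
have memC x : (x \in C) = ((- x)%R \in D).
  apply/imfsetP/idP => [[y yD ->]|xD]; first by rewrite opprK.
  by exists (- x)%R => //; rewrite opprK.
have MTF : sumset M T `<=` F.
  apply/fsubsetP => x /sumsetP[a [t [aM tT ->]]]; apply/FL.
  by apply: subgroupD; [|apply: ML|apply: TL].
have MF : M `<=` F by apply/fsubsetP => x /ML/FL.
pose NM := [fset (- x)%R | x in M].
have cNM : #|` NM| = #|` M| by rewrite card_imfset //; apply: oppr_inj.
have CT : [disjoint sumset C T & NM].
  apply/fdisjointP => x /sumsetP[c [t [cC' tT ->]]]; apply/negP.
  move=> /imfsetP[/= m mM e]; move: cC'; rewrite memC !inE => /andP[/negP + _].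
  apply; suff -> : (- c = m + t)%R by rewrite mem_sumset.
  by rewrite -[m]opprK -e opprD addrNK.
have CTF : sumset C T `<=` F.
  apply/fsubsetP => x /sumsetP[c [t [cC' tT ->]]]; apply/FL.
  apply: subgroupD; [by []| |exact: TL].
  move: cC'; rewrite memC inE => /andP[_ /FL] /(subgroupN gL).
  by rewrite opprK.
have NMF : NM `<=` F.
  by apply/fsubsetP => x /imfsetP[/= m mM ->]; apply/FL/(subgroupN gL)/ML.
have cCT := cardfsU_disjoint CTF NMF CT.
have cD : #|` D| + #|` sumset M T| = #|` F|.
  by rewrite cardfsDS // subnK // fsubset_leq_card.
have candC : candidate L T C.
  split.
  - by move=> x; rewrite memC inE => /andP[_ /FL] /(subgroupN gL); rewrite opprK.
  - rewrite cC; apply/cardfs_gt1P; exists u, v.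
    by rewrite !inE uY vY uv; split=> //; apply/FL.
  - have /cardfs_gt1P[x [y [xM yM xy]]] := M2.
    exists (- x)%R, (- y)%R; rewrite eqr_opp xy; split=> //.
    + by apply: subgroupN => //; apply: ML.
    + by apply: subgroupN => //; apply: ML.
    + by apply: (fdisjointP_sym CT); apply/imfsetP; exists x.
    + by apply: (fdisjointP_sym CT); apply/imfsetP; exists y.
(* The strict alternative would give [|F| < |C + T| + |M| <= |F|]; the other gives
   [|M| <= |C| = |F| - |M + T|]. *)
have := minM _ candC; move: cCT cD cC cNM.
move: (#|` C|) (#|` D|) (#|` NM|) (#|` sumset C T|) => c d n ct.
lia.
Qed.

(** By submodularity, the excesses of the intersection and the union of [M] and [N = M + g] sum to
    at most twice that of [M]. If [N] differs from [M], the smaller intersection has a strictly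
    larger excess, so the union has a strictly smaller one and cannot be a candidate. *)
Lemma atom_shift_inter L T M g : subgroup L -> (forall t, t \in T -> L t) ->
  T <> fset0 -> L g -> atom L T M -> 1 < #|` M `&` shift g M| -> shift g M = M.
Proof.
move=> gL TL T0 Lg aM I2; apply: contrapT => /eqP neq.
have aN := atom_shift gL Lg aM; set N := shift g M in I2 neq aN.
have cN : #|` N| = #|` M| := card_shift _ _.
have cNT : #|` sumset N T| = #|` sumset M T| by rewrite sumset_shiftl card_shift.
have [[ML M2 o2] minM] := aM; have [[NL _ _] _] := aN.
have ltI : #|` M `&` N| < #|` M|.
  rewrite ltnNge; apply: contra neq => leI.
  have /eqP e : M `&` N == M by rewrite eqEfcard fsubsetIl.
  by rewrite eq_sym eqEfcard cN leqnn andbT -{1}e fsubsetIr.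
have candI : candidate L T (M `&` N).
  split=> //; first by move=> x; rewrite inE => /andP[/ML].
  by apply: two_outsideS o2; apply/sumsetSl/fsubsetIl.
have UI := cardfsUI M N.
have UIT := cardfsUI (sumset M T) (sumset N T).
have leIT : #|` sumset (M `&` N) T| <= #|` sumset M T `&` sumset N T|.
  by apply/fsubset_leq_card; rewrite fsubsetI !sumsetSl ?fsubsetIl ?fsubsetIr.
have := minM _ candI; move: (UIT); rewrite -sumsetUl => {}UIT minI.
have [o2U|[F FL leF]] := two_outsideVfinite L (sumset (M `|` N) T).
  have candU : candidate L T (M `|` N).
    split=> //; first by move=> x; rewrite inE => /orP[/ML|/NL].
    by apply: leq_trans M2 _; apply/fsubset_leq_card/fsubsetUl.
  have := minM _ candU; lia.
(* At most one point of [F] is left, so [|F| <= |M + T| + |M| - 2], the intersection having at least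
   two points. *)
have := atom_card_leq gL TL FL aM.
have := cardfsID (sumset (M `|` N) T) F.
have := fsubset_leq_card (fsubsetIr F (sumset (M `|` N) T)).
lia.
Qed.

(** * Sidon sets *)

Definition sidon M : Prop := forall g, g <> 0%R -> #|` M `&` shift g M| <= 1.

(** If [M] and [M + g] share two points, then [M + g = M]. For [x], [y] in [M], the translate by
    [x - y] then shares [x] and [x + g] with [M], hence equals [M], and it contains [x - y]. *)
Lemma atom_subgroup_or_sidon L T M : subgroup L -> (forall t, t \in T -> L t) ->
  T <> fset0 -> 0%R \in M -> atom L T M -> subgroup [set` M] \/ sidon M.
Proof.
move=> gL TL T0 M0 aM; have [[ML _ _] _] := aM.
have [?|nM] := pselect (sidon M); [by right | left].
move: nM => /existsNP[g /not_implyP[/eqP g0 /negP]]; rewrite -ltnNge => I2.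
have Lg : L g.
  have /fset0Pn[x] : M `&` shift g M != fset0 by rewrite -cardfs_gt0; lia.
  rewrite inE mem_shift => /andP[/ML Lx /ML Lxg].
  by have := subgroupB gL Lx Lxg; rewrite subKr.
have eM := atom_shift_inter gL TL T0 Lg aM I2.
split=> //= x y xM yM.
have Lxy : L (x - y)%R by apply: subgroupB; [|apply: ML|apply: ML].
have <- : shift (x - y)%R M = M.
  apply: (atom_shift_inter gL TL T0 Lxy aM).
  apply/cardfs_gt1P; exists x, (x + g)%R.
  rewrite !inE !mem_shift subKr xM yM -{1}eM mem_shift addrK xM /=.
  have -> : (x + g - (x - y) = y + g)%R by rewrite opprB addrC addrA subrK.
  rewrite -{1}eM mem_shift addrK yM; split=> //.
  by rewrite -subr_eq0 opprD addrA subrr sub0r oppr_eq0.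
by rewrite mem_shift subrr.
Qed.

Lemma sidon_shift_inter M N x : sidon M -> x \notin N ->
  #|` shift x M `&` sumset M N| <= #|` N|.
Proof.
move=> sM; move cN: #|` N| => n.
elim: n N cN => [|n IHn] N cN xN.
  rewrite leqn0 cardfs_eq0; apply/eqP/fsetP => z; rewrite !inE.
  apply/negP => /andP[_ /sumsetP[a [b [_ + _]]]].
  by rewrite (cardfs0_eq cN) inE.
have /fset0Pn[y yN] : N != fset0 by rewrite -cardfs_gt0 cN.
have cN' : #|` N `\ y| = n by move: cN; rewrite (cardfsD1 y) yN => -[].
have xy : (x - y)%R <> 0%R by move=> /subr0_eq e; rewrite e yN in xN.
have xN' : x \notin N `\ y by rewrite !inE negb_and xN orbT.
have le1 : #|` shift y (M `&` shift (x - y)%R M)| <= 1 by rewrite card_shift sM.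
apply: (@leq_trans #|` shift y (M `&` shift (x - y)%R M)
                   `|` (shift x M `&` sumset M (N `\ y))|); last first.
  have := IHn _ cN' xN'; move: (cardfsUI (shift y (M `&` shift (x - y)%R M))
                   (shift x M `&` sumset M (N `\ y))); lia.
apply/fsubset_leq_card/fsubsetP => z; rewrite !inE !mem_shift => /andP[zx].
rewrite !inE mem_shift opprB addrA subrK zx andbT /=.
move=> /sumsetP[a [b [aM bN ->]]]; have [->|by'] := eqVneq b y.
  by rewrite addrK aM.
by apply/orP; right; rewrite mem_sumset // !inE by'.
Qed.

(** The translate of [M] added after [i] others brings at least [|M| - i] new points. Doubling
    avoids a division. *)
Lemma sidon_card_sumset M N : sidon M ->
  2 * (#|` N| * #|` M|) <= 2 * #|` sumset M N| + #|` N| * (#|` N| - 1).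
Proof.
move=> sM; move cN: #|` N| => n; elim: n N cN => [|n IHn] N cN //.
have /fset0Pn[y yN] : N != fset0 by rewrite -cardfs_gt0 cN.
have cN' : #|` N `\ y| = n by move: cN; rewrite (cardfsD1 y) yN => -[].
have yN' : y \notin N `\ y by rewrite !inE eqxx.
have le2 := sidon_shift_inter sM yN'; rewrite cN' in le2.
have := cardfsUI (shift y M) (sumset M (N `\ y)); rewrite card_shift => UI.
have leS : #|` shift y M `|` sumset M (N `\ y)| <= #|` sumset M N|.
  apply/fsubset_leq_card/fsubsetP => z; rewrite inE mem_shift => /orP[zM|].
    by rewrite -[z](subrK y) mem_sumset.
  move=> /sumsetP[a [b [aM]]]; rewrite !inE => /andP[_ bN] ->.
  by rewrite mem_sumset.
have := IHn _ cN'; nia.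
Qed.

(* A 2-atom N of M would be Sidon or a subgroup; both are excluded by counting
   the sums M + N in which the Sidon set M has few coincidences. *)
Lemma sidon_candidate_card M X : sidon M -> 0%R \in M -> 2 < #|` M| ->
  candidate (generated [set` M]) M X -> #|` X| + #|` M| <= #|` sumset X M|.
Proof.
set L := generated _ => sM M0 M3 cX; rewrite leqNgt; apply/negP => ltX.
have gL : subgroup L := subgroup_generated _.
have ML t : t \in M -> L t by move=> tM K [_]; exact.
have Mn0 : M <> fset0 by move=> e; rewrite e inE in M0.
have [N0 aN0] := atom_exists Mn0 cX.
have /fset0Pn[y yN0] : N0 != fset0.
  by have [[_ + _] _] := aN0; rewrite -cardfs_gt0; lia.
have Ly : L (- y)%R.
  by have [[NL _ _] _] := aN0; apply: (subgroupN gL); exact: NL.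
have aN := atom_shift gL Ly aN0; set N := shift _ N0 in aN.
have N00 : 0%R \in N by rewrite mem_shift opprK add0r.
have [[NL N2 o2] minN] := aN.
have ltN : #|` sumset N M| < #|` N| + #|` M| by have := minN _ cX; lia.
have le1 := sidon_card_sumset N sM; rewrite sumsetC in ltN.
(* With [n = |N|] and [m = |M|], the bounds give [2m(n - 1) <= (n - 1)(n + 2)], where [n >= 2]. *)
have leN : 2 * #|` M| <= #|` N| + 2.
  move: ltN le1 N2; move: (#|` sumset M N|) (#|` N|) (#|` M|) => a n m; nia.
have [gN|sN] := atom_subgroup_or_sidon gL ML Mn0 N00 aN.
  (* A point of [M] outside the subgroup [N] would put two cosets of [N] in [M + N], while
     [|M| <= |N|] by [leN]. *)
  have MN : M `<=` N.
    apply/fsubsetP => x xM; apply: contrapT => /negP xN.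
    suff : #|` N| + #|` N| <= #|` sumset M N| by lia.
    rewrite -{2}(card_shift x N); apply: cardfsU_disjoint.
    - by rewrite sumsetC; apply: sumset_addl.
    - apply/fsubsetP => z; rewrite mem_shift => zN.
      by rewrite -[z](subrK x) sumsetC mem_sumset.
    - apply/fdisjointP => z zN; rewrite mem_shift; apply: contra xN => zxN.
      by have := subgroupB gN zN zxN; rewrite subKr.
  have [u [_ [_ Lu _ /negP + _]]] := o2; apply.
  apply: (fsubsetP (sumset_addl N M0)).
  by apply: (Lu [set` N]); split=> // x xM; apply: (fsubsetP MN).
have le2 := sidon_card_sumset M sN; rewrite sumsetC in le2.
(* With the roles exchanged, the two bounds add up to [|M| + |N| <= 4]. *)
have : 2 * #|` N| <= #|` M| + 2.
  move: ltN le2 M3; move: (#|` sumset M N|) (#|` N|) (#|` M|) => a n m; nia.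
lia.
Qed.

(** * Splitting a set along the cosets of a subgroup *)

Definition coset_part L x S : {fset G} := [fset y in S | `[< L (y - x)%R >]].

Lemma mem_coset_part L x S y :
  (y \in coset_part L x S) = (y \in S) && `[< L (y - x)%R >].
Proof. by rewrite !inE. Qed.

Lemma coset_part_id L x S : subgroup L -> x \in S -> x \in coset_part L x S.
Proof.
by move=> gL xS; rewrite mem_coset_part xS subrr asboolT //; apply: subgroup0.
Qed.

Lemma card_coset_part L x S :
  #|` coset_part L x S| + #|` S `\` coset_part L x S| = #|` S|.
Proof.
rewrite -[RHS](cardfsID (coset_part L x S)); congr (#|` _| + _).
by apply/fsetP => y; rewrite inE mem_coset_part; case: (y \in S).
Qed.

Lemma sumset_coset_part L x S M : subgroup L -> (forall t, t \in M -> L t) ->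
  #|` sumset (coset_part L x S) M| + #|` sumset (S `\` coset_part L x S) M|
    <= #|` sumset S M|.
Proof.
move=> gL ML; apply: cardfsU_disjoint.
- apply: sumsetSl; apply/fsubsetP => y; by rewrite mem_coset_part => /andP[].
- by apply/sumsetSl/fsubsetDl.
apply/fdisjointP => z /sumsetP[a [t [+ tM ->]]].
rewrite mem_coset_part => /andP[aS /asboolP La]; apply/negP.
move=> /sumsetP[b [t' [+ t'M e]]]; rewrite inE mem_coset_part => /andP[/negP + bS].
rewrite bS; apply; apply/asboolP.
have -> : (b - x = (a - x) + (t - t'))%R.
  have -> : (a = b + (t' - t))%R by rewrite addrA -e addrK.
  by rewrite -[(t - t')%R]opprB [(b + _ - x)%R]addrAC addrK.
by apply: subgroupD => //; apply: subgroupB; [|apply: ML|apply: ML].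
Qed.

Lemma properI A u : u \notin A -> Defs.proper A.
Proof. by move=> /negP uA eA; apply: uA; have : [set` A] u by rewrite eA. Qed.

Lemma properPn A : ~ Defs.proper A -> forall z, z \in A.
Proof. by move=> /contrapT eA z; have : [set` A] z by rewrite eA. Qed.

(** * Size of the 2-atoms when subgroups expand *)

(** The form in which [H = 0] is used: by maximality, no such [K] is a fragment, so its excess is
    greater than [|S| - 1]. *)
Definition subgroup_expanding S : Prop :=
  forall K, subgroup [set` K] -> K <> [fset 0%R] -> Defs.proper (sumset K S) ->
    #|` K| + #|` S| <= #|` sumset K S|.

(** A larger [M] would be a Sidon set. In each coset of [L = <M>] meeting [S], at most one point
    avoids [S + M], and counting leaves at most one in all. So [L] is finite and
    [|L + S| <= |S + M| + 1 <= |S| + |M|]; expansion then forces [L = M], but [M] is not a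
    subgroup. *)
Lemma atom_card_leq2 S M : S <> fset0 -> subgroup_expanding S -> 0%R \in M ->
  atom [set: G] S M -> #|` sumset M S| < #|` M| + #|` S| -> #|` M| <= 2.
Proof.
move=> S0 hb M0 aM ltM; rewrite leqNgt; apply/negP => M3.
have [[_ M2 o2] minM] := aM; have [u0 [v0 [uv0 _ _ uM vM]]] := o2.
have gT : subgroup [set: G] by [].
have Mn0 K : M `<=` K -> K <> [fset 0%R].
  by move=> /fsubset_leq_card + e; rewrite e cardfs1; lia.
have nM : ~ subgroup [set` M].
  move=> gM; have := hb M gM (Mn0 _ (fsubset_refl _)) (properI uM); lia.
have sM : sidon M.
  by case: (@atom_subgroup_or_sidon setT S M gT (fun _ _ => I) S0 M0 aM).
pose L := generated [set` M]; have gL : subgroup L := subgroup_generated _.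
have ML t : t \in M -> L t by move=> tM K [_]; exact.
rewrite sumsetC in ltM.
have Mne : M <> fset0 by move=> e; rewrite e inE in M0.
pose P x := coset_part L x S.
have ltP x : #|` sumset (P x) M| < #|` P x| + #|` M|.
  have := sumset_coset_part x S gL ML; have := card_coset_part L x S.
  have := leq_card_sumset (S `\` P x) Mne; rewrite -/(P x); lia.
(* If [P x] were a single point, the rest [R] of [S] would satisfy [R + M = R]. *)
have P2 x : x \in S -> 1 < #|` P x|.
  move=> xS; rewrite ltnNge; apply/negP => P1.
  have xP : x \in P x := coset_part_id gL xS.
  have eP : P x = [fset x].
    by apply/eqP; rewrite eq_sym eqEfcard fsub1set xP cardfs1.
  have [R RE] : exists R, R = S `\` P x by exists (S `\` P x).
  have cPR := card_coset_part L x S.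
  have cPRM := sumset_coset_part x S gL ML.
  have cPM : #|` sumset (P x) M| = #|` M|.
    rewrite -(card_shift x M); congr #|` _|; apply/fsetP => z; rewrite mem_shift.
    rewrite eP; apply/sumsetP/idP => [[a [b []]]|zM].
      by rewrite inE => /eqP-> bM ->; rewrite addrC addKr.
    by exists x, (z - x)%R; split=> //; rewrite ?inE // addrC subrK.
  have leR := leq_card_sumset R Mne.
  rewrite -/(P x) -RE ?eP ?cardfs1 in cPR cPRM; rewrite eP in cPM.
  have eR : R = sumset R M.
    apply/eqP; rewrite eqEfcard sumset_addl // andTb; lia.
  have [p p0 pM] : exists2 p, p != 0%R & p \in M.
    have /cardfs_gt1P[y [z [yM zM yz]]] := M2.
    by have [y0|y0] := eqVneq y 0%R; [exists z; rewrite // -y0 eq_sym | exists y].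
  (* The pair [Q] has excess at most [|R|], which is at most that of [M]; minimality of [|M|] then
     gives [|M| <= 2]. *)
  pose Q := [fset 0%R; p].
  have cQ : #|` Q| = 2 by rewrite cardfs2 eq_sym p0.
  have QM : Q `<=` M by apply/fsubsetP => z; rewrite !inE => /orP[]/eqP->.
  have candQ : candidate setT S Q.
    split=> //; first by rewrite cQ.
    exact: two_outsideS (sumsetSl _ QM) o2.
  have leQ : #|` sumset Q S| <= #|` shift x Q| + #|` R|.
    have : sumset Q S `<=` shift x Q `|` R.
      apply/fsubsetP => z /sumsetP[q [t [qQ tS ->]]]; rewrite inE mem_shift.
      have [->|tx] := eqVneq t x; first by rewrite addrK qQ.
      rewrite eR [(q + t)%R]addrC mem_sumset ?orbT //; last exact: (fsubsetP QM).
      by rewrite RE inE tS eP inE tx.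
    move=> /fsubset_leq_card; have := cardfsUI (shift x Q) R; lia.
  rewrite card_shift cQ in leQ.
  have := minM _ candQ; rewrite cQ sumsetC.
  lia.
have shiftP x : candidate L M (shift (- x)%R (P x)) \/
    #|` P x| <= 1 \/ ~ two_outside L (shift (- x)%R (sumset (P x) M)).
  rewrite -sumset_shiftl.
  have [o|] := pselect (two_outside L (sumset (shift (- x)%R (P x)) M)).
    have [|leP] := ltnP 1 #|` P x|; last by right; left.
    rewrite -(card_shift (- x)%R) => P2'; left; split=> // y.
    by rewrite mem_shift opprK mem_coset_part addrK => /andP[_ /asboolP].
  by right; right.
have noP x : x \in S -> ~ two_outside L (shift (- x)%R (sumset (P x) M)).
  move=> xS; case: (shiftP x) => [/(sidon_candidate_card sM M0 M3)|[|//]].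
    by rewrite sumset_shiftl !card_shift; have := ltP x; lia.
  by have := P2 x xS; lia.
have /fset0Pn[x0 x0S] : S != fset0 by apply/eqP.
have [/(noP _ x0S) []|[F FL _]] :=
  two_outsideVfinite L (shift (- x0)%R (sumset (P x0) M)).
have gF : subgroup [set` F].
  split; first by apply/FL; exact: subgroup0 gL.
  by move=> x y /FL Lx /FL Ly; apply/FL; exact: subgroupB gL Lx Ly.
have MF : M `<=` F by apply/fsubsetP => x /ML/FL.
(* [P x] and [u - M] are disjoint in the coset [x + F], of which [P x + M] covers all but [u]. *)
have missing x u : x \in S -> L (u - x)%R -> u \notin sumset (P x) M ->
    #|` P x| + #|` M| <= (#|` sumset (P x) M|).+1.
  move=> xS Lux uP; apply: (@leq_trans #|` F|).
    pose uM' := [fset (u - m)%R | m in M].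
    rewrite -(card_shift x F).
    have <- : #|` uM'| = #|` M| by rewrite card_imfset // => a b /addrI/oppr_inj.
    apply: cardfsU_disjoint.
    - apply/fsubsetP => z; rewrite mem_coset_part mem_shift => /andP[_ /asboolP].
      by move/FL.
    - apply/fsubsetP => z /imfsetP[/= m mM ->]; rewrite mem_shift; apply/FL.
      by rewrite addrAC; apply: (subgroupB gL) => //; apply: ML.
    - apply/fdisjointP => z zP; apply/negP => /imfsetP[/= m mM e].
      by move: uP; rewrite -(subrK m u) -e mem_sumset.
  rewrite -(card_shift x F) -addn1 -(cardfs1 u).
  have : shift x F `<=` sumset (P x) M `|` [fset u].
    apply/fsubsetP => z; rewrite mem_shift => /FL Lz; rewrite !inE orbC.
    have [//|zu /=] := eqVneq z u; apply: contrapT => /negP zP.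
    apply: (noP x xS); exists (z - x)%R, (u - x)%R.
    by rewrite (inj_eq (addIr _)) !mem_shift opprK !subrK; split.
  move=> /fsubset_leq_card; have := cardfsUI (sumset (P x) M) [fset u]; lia.
have PS x z : z \notin sumset S M -> z \notin sumset (P x) M.
  apply: contra; apply/fsubsetP/sumsetSl/fsubsetP => y.
  by rewrite mem_coset_part => /andP[].
have uniq_missing u v : u \in sumset F S -> v \in sumset F S ->
    u \notin sumset S M -> v \notin sumset S M -> u = v.
  move=> /sumsetP[a [x [aF xS eu]]] /sumsetP[b [y [bF yS ev]]] uS vS.
  apply/eqP; apply: contrapT => /negP uv.
  have Lux : L (u - x)%R by rewrite eu addrK; apply/FL.
  have Lvy : L (v - y)%R by rewrite ev addrK; apply/FL.
  have [Lyx|nLyx] := pselect (L (y - x)%R).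
    apply: (noP x xS); exists (u - x)%R, (v - x)%R.
    rewrite (inj_eq (addIr _)) !mem_shift opprK !subrK; split=> //; try exact: PS.
    by rewrite -(subrK y v) -addrA; apply: (subgroupD gL).
  (* Two deficient cosets would give [|S + M| >= |S| + 2|M| - 2], too much when [|M| >= 3]. *)
  have mx := missing x u xS Lux (PS _ _ uS).
  have my := missing y v yS Lvy (PS _ _ vS).
  have cx := card_coset_part L x S; have cy := card_coset_part L y (S `\` P x).
  have sx := sumset_coset_part x S gL ML.
  have sy := sumset_coset_part y (S `\` P x) gL ML.
  have eP : coset_part L y (S `\` P x) = P y.
    apply/fsetP => z; rewrite /P !(mem_coset_part, inE).
    case zS : (z \in S); rewrite ?andbF //= andbT.
    apply: andb_idl => /asboolP Lzy; apply/negP => /asboolP Lzx.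
    apply: nLyx; have := subgroupB gL Lzx Lzy.
    by rewrite opprB addrC addrA subrK.
  rewrite eP -/(P x) in cx cy sx sy.
  move: mx my cx cy sx sy ltM M3 (leq_card_sumset ((S `\` P x) `\` P y) Mne).
  by clear; lia.
have pF : Defs.proper (sumset F S).
  move=> /= eF; have inF z : z \in sumset F S.
    by have : [set` sumset F S] z by rewrite eF.
  by move: uv0; rewrite (uniq_missing u0 v0) ?eqxx // sumsetC.
have := hb F gF (Mn0 _ MF) pF.
have leF : #|` sumset F S| <= #|` sumset S M| + 1.
  rewrite -(cardfsID (sumset S M)) leq_add //.
    exact/fsubset_leq_card/fsubsetIr.
  rewrite leqNgt; apply/negP => /cardfs_gt1P[u [v []]].
  rewrite !inE => /andP[uS uF] /andP[vS vF].
  by rewrite (uniq_missing u v) ?eqxx.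
move=> leFS; apply: nM; have /eqP-> // : M == F.
by rewrite eqEfcard MF andTb; lia.
Qed.

(** * Periods, and sets with a two-element atom *)

(** Searching among the differences of [X] keeps this finite and loses no period of a non-empty
    [X]. *)
Definition stabilizer X : {fset G} := [fset z in diffset X X | shift z X == X].

Lemma mem_stabilizer X z : X <> fset0 -> (z \in stabilizer X) = (shift z X == X).
Proof.
move=> /eqP/fset0Pn[x xX]; rewrite !inE; apply: andb_idl => /eqP eX.
by rewrite -[z](addKr x) addrC mem_diffset // -eX mem_shift addrK.
Qed.

Lemma subgroup_stabilizer X : X <> fset0 -> subgroup [set` stabilizer X].
Proof.
move=> X0; split=> [|x y] /=; rewrite !mem_stabilizer //.
  by apply/eqP/fsetP => z; rewrite mem_shift subr0.
move=> /eqP ex /eqP ey; apply/eqP/fsetP => z; rewrite mem_shift opprB addrA.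
by rewrite -[in RHS]ex -{1}ey !mem_shift addrAC addrK.
Qed.

Lemma sumset_stabilizer X : X <> fset0 -> sumset (stabilizer X) X = X.
Proof.
move=> X0; apply/eqP; rewrite eq_sym eqEfsubset; apply/andP; split.
  rewrite sumsetC; apply: sumset_addl.
  by case: (subgroup_stabilizer X0).
apply/fsubsetP => z /sumsetP[a [x [+ xX ->]]].
by rewrite mem_stabilizer // => /eqP <-; rewrite mem_shift addrC addKr.
Qed.

Lemma card_stabilizer X : X <> fset0 -> #|` stabilizer X| <= #|` X|.
Proof.
move=> X0; rewrite -[in leqRHS](sumset_stabilizer X0).
exact: leq_card_sumset.
Qed.

Lemma shift_stable X d : (forall x, x \in X -> (x + d)%R \in X) -> shift d X = X.
Proof.
move=> Xd; apply/eqP; rewrite eqEfcard card_shift leqnn andbT.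
by apply/fsubsetP => x; rewrite mem_shift => /Xd; rewrite subrK.
Qed.

Lemma diffset_full S A : (forall z, z \in A) -> #|` A| < 2 * #|` S| ->
  forall z, z \in diffset S S.
Proof.
move=> Afull leA z; apply: contrapT => /negP zS.
have : #|` S| + #|` shift z S| <= #|` A|.
  apply: cardfsU_disjoint; [by apply/fsubsetP..|].
  apply/fdisjointP => x xS; rewrite mem_shift; apply: contra zS => xzS.
  by rewrite -[z](subKr x) mem_diffset.
by rewrite card_shift; move: leA; lia.
Qed.

(* A single x in S has x + d outside S, so S is a progression of difference d
   ending there, together with a d-periodic set. *)
Lemma pair_structure S d : d <> 0%R -> S <> fset0 -> subgroup_expanding S ->
  Defs.proper S -> #|` sumset S [fset 0%R; d]| <= #|` S| + 1 ->
  arith_prog S \/ forall z, z \in diffset S S.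
Proof.
move=> d0 S0 hb pS leS.
pose E := [fset x in S | (x + d)%R \notin S].
have memE x : (x \in E) = (x \in S) && ((x + d)%R \notin S) by rewrite !inE.
have E1 : #|` E| <= 1.
  have : #|` S| + #|` shift d E| <= #|` sumset S [fset 0%R; d]|.
    apply: cardfsU_disjoint.
    - by apply: sumset_addl; rewrite !inE eqxx.
    - apply/fsubsetP => x; rewrite mem_shift memE => /andP[xS _].
      by rewrite -(subrK d x) mem_sumset // !inE eqxx orbT.
    - apply/fdisjointP => x xS; rewrite mem_shift memE subrK xS.
      by rewrite andbF.
  by rewrite card_shift; move: leS; clear; lia.
have stab X : X <> fset0 -> shift d X = X ->
    d \in stabilizer X /\ stabilizer X <> [fset 0%R].
  move=> X0 eX; have dX : d \in stabilizer X by rewrite mem_stabilizer // eX.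
  by split=> // e; move: dX; rewrite e inE => /eqP.
have [E0|/fset0Pn[e]] := eqVneq E fset0.
  have eS : shift d S = S.
    apply: shift_stable => x xS; apply: contrapT => /negP xdS.
    have : x \in E by rewrite memE xS.
    by rewrite E0 inE.
  have [dK K0] := stab _ S0 eS.
  have := hb _ (subgroup_stabilizer S0) K0; rewrite sumset_stabilizer // => /(_ pS).
  have : 0 < #|` stabilizer S| by rewrite cardfs_gt0; apply/fset0Pn; exists d.
  by clear; lia.
move=> eE; have := eE; rewrite memE => /andP[eS edS].
have Ee x : x \in S -> x != e -> (x + d)%R \in S.
  move=> xS xe; apply: contrapT => /negP xdS; move: E1; rewrite leqNgt => /negP; apply.
  by apply/cardfs_gt1P; exists x, e; rewrite memE xS xdS; split.
(* Otherwise the points [e - d *+ k] form a finite set stable under subtracting [d], hence under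
   adding it, and [e + d] is in [S]. *)
have exk : exists k, (e - d *+ k)%R \notin S.
  apply: contrapT => nk.
  have inS k : (e - d *+ k)%R \in S.
    by apply: contrapT => /negP kS; apply: nk; exists k.
  pose B := [fset x in S | `[< exists k, x = (e - d *+ k)%R >]].
  have BE x : (x \in B) = (x \in S) && `[< exists k, x = (e - d *+ k)%R >].
    by rewrite !inE.
  have memB k : (e - d *+ k)%R \in B.
    by rewrite BE inS; apply/asboolP; exists k.
  have eB : shift (- d)%R B = B.
    apply: shift_stable => x; rewrite {1}BE => /andP[_ /asboolP[k ->]].
    by rewrite -addrA -opprD -mulrSr memB.
  have := memB 0; rewrite mulr0n subr0 -eB mem_shift opprK BE.
  by rewrite (negPf edS).
case: (ex_minnP exk) => k kS mink.
have k0 : 0 < k by rewrite lt0n; apply: contraNneq kS => ->; rewrite mulr0n subr0.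
pose A : {fset G} := [fset (e + (- d) *+ i)%R | i in iota 0 k].
have AP x : reflect (exists2 i, i < k & x = (e - d *+ i)%R) (x \in A).
  apply: (iffP (imfsetP _ _ _ _)) => /= -[i ik ->]; exists i;
    by rewrite ?mulNrn //; move: ik; rewrite mem_iota add0n.
have [S'0|/eqP S'0] := eqVneq (S `\` A) fset0.
  left; exists e, (- d)%R, k; split=> //; rewrite -/A.
  apply/eqP; rewrite eqEfsubset -fsetD_eq0 S'0 eqxx /=.
  apply/fsubsetP => x /AP[i ik ->]; apply: contrapT => /negP /mink.
  by rewrite leqNgt ik.
right; set S' := S `\` A in S'0.
have eA : e \in A by apply/AP; exists 0; rewrite // mulr0n subr0.
(* If [x + d] were the term [e - d *+ i] of [A], then [x] would be the next term, or outside [S]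
   when [i.+1 = k]. *)
have eS' : shift d S' = S'.
  apply: shift_stable => x; rewrite !inE => /andP[xA xS].
  rewrite Ee ?andbT //; last by apply: contraNneq xA => ->.
  apply: contra xA => /AP[i ik exd]; apply/AP; exists i.+1.
    rewrite ltn_neqAle ik andbT; apply: contraNneq kS => <-.
    by rewrite mulrSr opprD addrA -exd addrK.
  by rewrite mulrSr opprD addrA -exd addrK.
have [dK K0] := stab _ S'0 eS'; set K := stabilizer S' in dK K0.
have gK : subgroup [set` K] := subgroup_stabilizer S'0.
have ltS : #|` S'| < #|` S|.
  have := cardfsU_disjoint (fsubsetDl S A) (_ : [fset e] `<=` S).
  rewrite fsub1set eS cardfs1 fdisjointX1 !inE eA /= => /(_ isT isT).
  by rewrite -/S'; clear; lia.
(* As [d] is in [K], all of [A] lies in [e + K]. The bound is below [|S| + |K|], so expansion forces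
   [K + S = G], and [|K| <= |S'|] gives [|G| < 2|S|]. *)
have leK : #|` sumset K S| <= #|` S'| + #|` K|.
  rewrite -(card_shift e K).
  have : sumset K S `<=` S' `|` shift e K.
    apply/fsubsetP => z /sumsetP[a [x [aK xS ->]]]; rewrite inE mem_shift.
    have [/AP[i _ ->]|xA] := boolP (x \in A).
      apply/orP; right; rewrite addrA [(a + e)%R]addrC -addrA [(e + _)%R]addrC addrK.
      apply: (subgroupB gK) => //=.
      elim: i => [|i IHi]; first exact: subgroup0 gK.
      by rewrite mulrSr; apply: (subgroupD gK).
    by rewrite -{1}(sumset_stabilizer S'0) mem_sumset // inE xA.
  move=> /fsubset_leq_card; have := cardfsUI S' (shift e K); clear; lia.
have cK := card_stabilizer S'0.
have : ~ Defs.proper (sumset K S).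
  move=> /(hb _ gK K0); move: ltS leK; clear; lia.
move=> /properPn KS; apply: (diffset_full KS).
move: ltS leK cK; rewrite -/K; clear; lia.
Qed.

(** * Vosper's property and the growth of iterated sums *)

(** That is, [|X + S| >= min(|G| - 1, |X| + |S|)] when [|X| >= 2], in a form that allows an infinite
    [G]. *)
Definition vosper S : Prop := forall X, 1 < #|` X| ->
  two_outside [set: G] (sumset X S) -> #|` X| + #|` S| <= #|` sumset X S|.

(** A set violating [vosper] yields a 2-atom; translated to contain [0], it is a pair by
    [atom_card_leq2], and [pair_structure] applies. *)
Lemma vosper_trichotomy S : S <> fset0 -> Defs.proper S -> subgroup_expanding S ->
  [\/ arith_prog S, forall z, z \in diffset S S | vosper S].
Proof.
move=> S0 pS hb; have [?|] := pselect (vosper S); first by constructor 3.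
move=> /existsNP[X /not_implyP[X2 /not_implyP[oX /negP]]]; rewrite -ltnNge => ltX.
have gT : subgroup [set: G] by [].
have [M0 aM0] := atom_exists S0 (And3 (fun _ _ => I) X2 oX : candidate setT S X).
have /fset0Pn[y yM0] : M0 != fset0.
  by have [[_ + _] _] := aM0; rewrite -cardfs_gt0; apply: ltnW.
have aM := @atom_shift setT S M0 (- y)%R gT I aM0; set M := shift _ M0 in aM.
have M00 : 0%R \in M by rewrite mem_shift opprK add0r.
have [[_ M2 _] minM] := aM.
have ltM : #|` sumset M S| < #|` M| + #|` S|.
  have := minM X (And3 (fun _ _ => I) X2 oX).
  by move: ltX; clear; lia.
have M2' := atom_card_leq2 S0 hb M00 aM ltM.
have [d d0 dM] : exists2 d, d <> 0%R & d \in M.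
  have /cardfs_gt1P[x [z [xM zM xz]]] := M2.
  have [x0|/eqP x0] := eqVneq x 0%R; last by exists x.
  by exists z => //; apply/eqP; rewrite -x0 eq_sym.
have eM : M = [fset 0%R; d].
  apply/eqP; rewrite eq_sym eqEfcard cardfs2 eq_sym (introF eqP d0) M2' andbT.
  by apply/fsubsetP => z; rewrite !inE => /orP[]/eqP->.
have leS : #|` sumset S [fset 0%R; d]| <= #|` S| + 1.
  by rewrite -eM sumsetC; move: ltM M2'; clear; lia.
by have [] := pair_structure d0 S0 hb pS leS; [constructor 1 | constructor 2].
Qed.

Lemma min_card_pred_leq n : min_card_pred G n <= n.
Proof. by rewrite /min_card_pred; case: asboolP => // _; apply: geq_minr. Qed.

Lemma min_card_predD n k : min_card_pred G (n + k) <= min_card_pred G n + k.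
Proof. by rewrite /min_card_pred; case: asboolP => // _; lia. Qed.

Lemma min_card_pred_fset F n : (forall z, z \in F) -> min_card_pred G n <= #|` F| - 1.
Proof.
move=> Ffull; have eF : [set: G] = [set` F].
  by apply/seteqP; split=> z _ //=; exact: Ffull.
rewrite /min_card_pred eF set_fsetK asboolT; last exact: finite_fset.
exact: geq_minl.
Qed.

Lemma vosper_step S X n : vosper S -> 1 < #|` X| -> min_card_pred G n <= #|` X| ->
  min_card_pred G (n + #|` S|) <= #|` sumset S X|.
Proof.
rewrite sumsetC => vS X2 leX.
have [oX|[F Ffull leF]] := two_outsideVfinite [set: G] (sumset X S).
  by move: (vS X X2 oX) leX (min_card_predD n #|` S|); clear; lia.
have {}Ffull z : z \in F by apply/Ffull.
apply: leq_trans (min_card_pred_fset _ Ffull) _; rewrite leq_subLR.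
rewrite -(cardfsID (sumset X S)) addnC leq_add //.
exact/fsubset_leq_card/fsubsetIr.
Qed.

Lemma vosper_iter S X n k : S <> fset0 -> vosper S -> 1 < #|` X| ->
  min_card_pred G n <= #|` X| ->
  1 < #|` iter k (sumset S) X| /\
  min_card_pred G (n + k * #|` S|) <= #|` iter k (sumset S) X|.
Proof.
move=> S0 vS X2 leX; elim: k => [|k [IH2 IHle]]; first by rewrite addn0.
rewrite iterS; split.
  by apply: leq_trans IH2 _; rewrite sumsetC; apply: leq_card_sumset.
by rewrite mulSn addnCA addnC; apply: vosper_step.
Qed.

(** This presents [sS - rS] as [s] copies of [S] added to [-rS]. *)
Lemma diffset_iter S A B k :
  diffset (iter k (sumset S) A) B = iter k (sumset S) (diffset A B).
Proof.
elim: k => // k IHk; rewrite !iterS -IHk; apply/fsetP => x.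
apply/diffsetP/sumsetP.
  move=> [_ [b [/sumsetP[s [a [sS aA ->]]] bB ->]]].
  by exists s, (a - b)%R; rewrite addrA mem_diffset.
move=> [s [_ [sS /diffsetP[a [b [aA bB ->]]] ->]]].
by exists (s + a)%R, b; rewrite addrA mem_sumset.
Qed.

Lemma card_diffset0l B : #|` diffset [fset 0%R] B| = #|` B|.
Proof.
transitivity #|` [fset (- b)%R | b in B]|; last first.
  by rewrite card_imfset //; apply: oppr_inj.
congr #|` _|; apply/fsetP => x; apply/diffsetP/imfsetP => /=.
  by move=> [a [b [/[!inE] /eqP-> bB ->]]]; exists b; rewrite ?sub0r.
by move=> [b bB ->]; exists 0%R, b; rewrite sub0r inE eqxx.
Qed.

(** Growth starts from one copy of [S], as [vosper] needs two points. After [r] more copies the sum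
    is negated, keeping its cardinality, and [s] copies are added. *)
Lemma vosper_card S r s : 1 < #|` S| -> vosper S ->
  min_card_pred G ((r.+1 + s) * #|` S|) <= #|` diffset (ksum s S) (ksum r.+1 S)|.
Proof.
move=> S2 vS; have S0 : S <> fset0 by move=> e; rewrite e cardfs0 in S2.
rewrite /ksum diffset_iter iterSr sumsetC sumset0l.
have [R2 leR] := vosper_iter r S0 vS S2 (min_card_pred_leq _).
rewrite -(card_diffset0l (iter r _ _)) in R2 leR.
have [_] := vosper_iter s S0 vS R2 leR.
by rewrite mulnDl mulSn.
Qed.

Lemma ksum_neq0 S k : S <> fset0 -> exists x, x \in ksum k S.
Proof.
move=> /eqP/fset0Pn[y yS]; elim: k => [|k [x xS]]; first by exists 0%R; rewrite inE.
by exists (y + x)%R; rewrite /ksum iterS mem_sumset.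
Qed.

Lemma diffset_ksum_full S r s : S <> fset0 -> (forall z, z \in diffset S S) ->
  forall z, z \in diffset (ksum s.+1 S) (ksum r.+1 S).
Proof.
move=> S0 Sfull z; have [a aS] := ksum_neq0 s S0; have [b bS] := ksum_neq0 r S0.
have /diffsetP[x [y [xS yS e]]] := Sfull (z - (a - b))%R.
have -> : z = (x + a - (y + b))%R by rewrite opprD addrACA -e subrK.
by rewrite mem_diffset // /ksum iterS mem_sumset.
Qed.

(** * Periodicity when [H] is non-zero *)

(** [H + S] contains the cosets [x + H] and [y + H] and the rest [R] of [S], so
    [2|H| + |R| < |H| + |S|]. *)
Lemma coset_part_sum_gt S H x y : subgroup [set` H] ->
  #|` sumset H S| < #|` H| + #|` S| -> x \in S -> y \in S -> (y - x)%R \notin H ->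
  #|` H| < #|` coset_part [set` H] x S| + #|` coset_part [set` H] y S|.
Proof.
move=> gH ltH xS yS nxy; pose P z := coset_part [set` H] z S.
pose R := (S `\` P x) `\` P y.
have memP u z : (z \in P u) = (z \in S) && ((z - u)%R \in H).
  by rewrite mem_coset_part; congr (_ && _); apply/asboolP/idP.
have cS : #|` S| <= #|` P x| + #|` P y| + #|` R|.
  have := cardfsID (P x) S; have := cardfsID (P y) (S `\` P x).
  have := fsubset_leq_card (fsubsetIr S (P x)).
  have := fsubset_leq_card (fsubsetIr (S `\` P x) (P y)).
  by rewrite -/R; clear; lia.
have H0 : 0%R \in H := subgroup0 gH.
have sub z : z \in S -> shift z H `<=` sumset H S.
  move=> zS; apply/fsubsetP => w; rewrite mem_shift => wH.
  by rewrite -(subrK z w) mem_sumset.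
have cH : #|` H| + #|` H| + #|` R| <= #|` sumset H S|.
  have cU : #|` shift x H `|` shift y H| = #|` H| + #|` H|.
    rewrite -{2}(card_shift y H) -{1}(card_shift x H) -cardfsUI.
    suff -> : shift x H `&` shift y H = fset0 by rewrite cardfs0 addn0.
    apply/eqP; apply/fdisjointP => w; rewrite !mem_shift => wx.
    apply: contra nxy => wy; have := subgroupB gH wx wy.
    by rewrite opprB addrC addrA subrK.
  rewrite -cU; apply: cardfsU_disjoint; first by rewrite fsubUset !sub.
    by rewrite sumsetC; apply: fsubset_trans (sumset_addl _ H0);
      apply: fsubset_trans (fsubsetDl _ _) (fsubsetDl _ _).
  apply/fdisjointP_sym => w.
  rewrite /R in_fsetU !in_fsetD !mem_shift !memP => /and3P[wy wx wS].
  by move: wy wx; rewrite wS /= => /negPf-> /negPf->.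
by move: cS cH ltH; rewrite /P; clear; lia.
Qed.

(* Parts of S in two distinct H-cosets have more than |H| elements together, so
   by the pigeonhole principle their difference sets fill whole H-cosets. *)
Lemma diffset_periodic S H x y h : subgroup [set` H] ->
  #|` sumset H S| < #|` H| + #|` S| ->
  (forall z, z \in S -> exists2 w, w \in S & (w - z)%R \notin H) ->
  x \in S -> y \in S -> h \in H -> (x - y + h)%R \in diffset S S.
Proof.
move=> gH ltH nS xS yS hH; set z := (x - y + h)%R.
apply: contrapT => /negP zS.
have memP u w : (w \in coset_part [set` H] u S) = (w \in S) && ((w - u)%R \in H).
  by rewrite mem_coset_part; congr (_ && _); apply/asboolP/idP.
(* As [z] is not in [S - S], the part at [u] and the part at [v] translated by [z] are disjoint in
   [u + H]. *)
have leP u v : (u - v - z)%R \in H ->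
    #|` coset_part [set` H] u S| + #|` coset_part [set` H] v S| <= #|` H|.
  move=> uvz; rewrite -(card_shift z (coset_part _ v S)) -(card_shift u H).
  apply: cardfsU_disjoint.
  - by apply/fsubsetP => w; rewrite memP mem_shift => /andP[].
  - apply/fsubsetP => w; rewrite !mem_shift memP => /andP[_ wv].
    have := subgroupB gH wv uvz; congr ([set` H] _).
    by rewrite opprB (addrAC w) addrA subrK opprB addrA subrK.
  - apply/fdisjointP => w; rewrite mem_shift !memP => /andP[wS _].
    apply: contra zS => /andP[wzS _].
    by rewrite -[z](subKr w) mem_diffset.
have xyz : (x - y - z)%R \in H.
  by rewrite /z opprD addrA subrr sub0r; apply: (subgroupN gH).
have [yx|nyx] := boolP ((y - x)%R \in H); last first.
  by move: (leP x y xyz) (coset_part_sum_gt gH ltH xS yS nyx); clear; lia.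
have zH : (- z)%R \in H.
  have := subgroupD gH yx xyz; congr ([set` H] _).
  by rewrite addrA -opprB addNr sub0r.
(* Since [z] is in [H], each part fills at most half of its coset; the second coset met by [S] gives
   the contradiction. *)
have [w wS nwx] := nS x xS.
have lex : (x - x - z)%R \in H by rewrite subrr sub0r.
have lew : (w - w - z)%R \in H by rewrite subrr sub0r.
move: (leP x x lex) (leP w w lew) (coset_part_sum_gt gH ltH xS wS nwx).
by clear; lia.
Qed.

End Isoperimetric.

(** * Combining the cases [H = 0] and [H <> 0] *)

Theorem theorem15 (r s : nat) (G : zmodType) (S H : {fset G})
  (hs : 1 <= s) (hrs : s <= r)
  (hSne : S <> fset0) (hSproper : [set` S] <> [set: G])
  (hSgen : generated [set` diffset S S] = [set: G])
  (hH : hyperatom S H) :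
  [\/ arith_prog S,
      min_card_pred G ((r + s) * #|` S|) <= #|` diffset (ksum s S) (ksum r S)|
    | H <> [fset 0%R]%fset /\
      sumset (diffset (ksum s S) (ksum r S)) H
      = diffset (ksum s S) (ksum r S)].
Proof.
have [gH [[H0 pH] eH] maxH] := hH.
have [_ minkappa] := kappa1P hSproper.
have adm0 : admissible S [fset 0%R]%fset.
  split; last by rewrite sumset0l.
  by apply/eqP/fset0Pn; exists 0%R; rewrite inE.
have exc0 : excess S [fset 0%R]%fset = #|` S| - 1.
  by rewrite /excess sumset0l cardfs1.
have S1 : 0 < #|` S| by rewrite cardfs_gt0; apply/eqP.
case: s hs hrs => // s _; case: r => // r _.
have [eH0|nH0] := pselect (H = [fset 0%R]%fset).
  have expS : subgroup_expanding S.
    move=> K gK K0 pK; have K00 : 0%R \in K := subgroup0 gK.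
    have aK : admissible S K.
      by split=> //; apply/eqP/fset0Pn; exists 0%R.
    have le1 : kappa1 S <= excess S K by apply: minkappa; exists K.
    have ne : excess S K <> kappa1 S.
      move=> eK; apply: K0; rewrite -eH0; apply: maxH => //.
      by rewrite eH0 fsub1set.
    move: (leq_card_sumset K hSne) le1 ne exc0 S1; rewrite -eH -eH0 /excess.
    by clear; lia.
  (* A one-point [S] is a progression; otherwise the iteration can start from [S]. *)
  have [S2|Sle1] := ltnP 1 #|` S|; last first.
    constructor 1; have /cardfs1P[a ->] : #|` S| == 1 by rewrite eqn_leq Sle1.
    exists a, 0%R, 1; split=> //; apply/fsetP => x; rewrite inE.
    apply/eqP/imfsetP => /= [->|[i _ ->]]; last by rewrite mul0rn addr0.
    by exists 0; rewrite ?mul0rn ?addr0.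
  have [?|Sfull|vS] := vosper_trichotomy hSne hSproper expS.
  - by constructor 1.
  - constructor 2; have Afull := diffset_ksum_full r s hSne Sfull.
    exact: leq_trans (min_card_pred_fset _ Afull) (leq_subr _ _).
  - by constructor 2; apply: vosper_card.
constructor 3; split=> //.
have ltH : #|` sumset H S| < #|` H| + #|` S|.
  have : kappa1 S <= excess S [fset 0%R]%fset.
    by apply: minkappa; exists [fset 0%R]%fset.
  by rewrite -eH exc0 /excess; move: S1; clear; lia.
(* If [S] lay in one coset of [H], then [S - S], and so [G], would lie in [H], making
   [H + S = G]. *)
have nS z : z \in S -> exists2 w, w \in S & (w - z)%R \notin H.
  move=> zS; apply: contrapT => nw; apply: pH.
  have wH w : w \in S -> (w - z)%R \in H.
    by move=> wS; apply: contrapT => /negP nwz; apply: nw; exists w.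
  apply/seteqP; split=> // x _ /=; rewrite -[x](subrK z) mem_sumset //.
  have : generated [set` diffset S S] (x - z)%R by rewrite hSgen.
  move=> gxz; apply: (gxz [set` H]); split=> // u /diffsetP[a [b [aS bS ->]]].
  have := subgroupB gH (wH a aS) (wH b bS).
  by rewrite opprB addrA subrK.
(* One summand [S] taken from each side absorbs [h]. *)
apply/eqP; rewrite eq_sym eqEfsubset sumset_addl; last exact: subgroup0 gH.
apply/fsubsetP => u /sumsetP[_ [h [/diffsetP[a [b [+ + ->]]] hH' ->]]].
rewrite /ksum !iterS => /sumsetP[x [a' [xS a'S ->]]] /sumsetP[y [b' [yS b'S ->]]].
have /diffsetP[x' [y' [x'S y'S e]]] := diffset_periodic gH ltH nS xS yS hH'.
have -> : (x + a' - (y + b') + h = x' + a' - (y' + b'))%R.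
  by rewrite !opprD (addrACA x) (addrACA x') -e [RHS]addrAC.
by rewrite mem_diffset // mem_sumset.
Qed.
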